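(* Let $0<\alpha<1$, and let $\mathcal X_M,\mathcal T_M,\mathcal Y_M$ be the spatial, temporal and full parabolic oscillations of a matrix field $M$ defined in the context. (1) If $\sup_t\|M(t)\|_{C^\alpha_x}\le K$, then $\mathcal X_M(z_0,r)\le C_\alpha Kr^\alpha$ for all $z_0,r$ (with $Q_r(z_0)$ in the domain of $M$), where $C_\alpha$ depends only on $\alpha$. (2) The temporal part is not controlled by this hypothesis: for a constant matrix $B\neq0$ and $$M(t,x)=\sin\Bigl(\frac1{T-t}\Bigr)B\qquad(t<T),$$ one has $\sup_{t<T}\|M(t)\|_{C^\alpha_x}=|B|$ and $\mathcal X_M((x_0,T),r)=0$ for every $r$, yet $$\lim_{r\downarrow0}\mathcal Y_M((x_0,T),r)^2=\lim_{r\downarrow0}\mathcal T_M((x_0,T),r)^2=\frac{|B|^2}{2}.$$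
   Context: $M$ is a $3\times3$-matrix-valued field of $(t,x)$, with $x$ in $\mathbb{R}^3$ or $\mathbb{T}^3$. For $z_0=(x_0,t_0)$ and $r>0$: $I_r=(t_0-r^2,t_0]$, $B_r=B_r(x_0)$, $Q_r(z_0)=B_r(x_0)\times(t_0-r^2,t_0]$. A bar on an integral, written $\frac{1}{|E|}\int_E$, denotes the normalized integral; $(M)_{Q_r}$ is the average of $M$ over $Q_r(z_0)$ and $m_r(t):=\frac1{|B_r|}\int_{B_r(x_0)}M(t,x)\,\mathrm dx$. Define $$\mathcal Y_M(z_0,r)^2:=\frac1{|Q_r|}\int_{Q_r(z_0)}|M-(M)_{Q_r}|^2,$$ $$\mathcal X_M(z_0,r)^2:=\frac1{|I_r|}\int_{I_r}\frac1{|B_r|}\int_{B_r}|M(t,x)-m_r(t)|^2\,\mathrm dx\,\mathrm dt,\qquad \mathcal T_M(z_0,r)^2:=\frac1{|I_r|}\int_{I_r}|m_r(t)-(M)_{Q_r}|^2\,\mathrm dt.$$ $|\cdot|$ is the matrix norm, and $\|\cdot\|_{C^\alpha_x}$ is the sup norm plus the $\alpha$-Hölder seminorm in $x$, taken with respect to this matrix norm. *)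

(* Defs.v *)
From HB Require Import structures.
From mathcomp Require Import all_boot all_order all_algebra.
From mathcomp Require Import all_classical all_reals all_analysis.
Set Implicit Arguments.
Unset Strict Implicit.
Unset Printing Implicit Defensive.
Import Order.TTheory GRing.Theory Num.Theory.
Import numFieldNormedType.Exports.
Local Open Scope classical_set_scope.
Local Open Scope ring_scope.

Section Norm.
Variable R : realType.

(* The library's norm on 'M[R]_3 is the entrywise maximum; here the matrix norm
   is an arbitrary one (Frobenius, operator norm, ...), hence this record. *)
Record matrix_norm := MatrixNorm {
  mxnorm :> 'M[R]_3 -> R ;
  mxnormD : forall A B, mxnorm (A + B) <= mxnorm A + mxnorm B ;
  mxnormZ : forall (a : R) A, mxnorm (a *: A) = `|a| * mxnorm A ;
  mxnorm_eq0 : forall A, mxnorm A = 0 -> A = 0 }.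

End Norm.

Section Space.
Variable R : realType.

(* R^3 is R * R * R rather than 'rV[R]_3 because products of measurable types
   carry the product Lebesgue measure. The canonical norm of R * R * R is the
   maximum norm, so the Euclidean distance is written out. *)
Definition edist (x y : R * R * R) : R :=
  Num.sqrt ((x.1.1 - y.1.1) ^+ 2 + (x.1.2 - y.1.2) ^+ 2 + (x.2 - y.2) ^+ 2).

(* Torus L is (R / L Z)^3, represented by the fundamental domain [0, L)^3 with
   the quotient distance. *)
Inductive spatial_domain := Euclidean | Torus of {posnum R}.

Definition carrier (S : spatial_domain) : set (R * R * R) :=
  match S with
  | Euclidean => setT
  | Torus L => [set x | [/\ 0 <= x.1.1 < L%:num, 0 <= x.1.2 < L%:num
                          & 0 <= x.2 < L%:num]]
  end.

Definition translate (L : R) (x : R * R * R) (k : int * int * int) : R * R * R :=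
  (x.1.1 + L * k.1.1%:~R, x.1.2 + L * k.1.2%:~R, x.2 + L * k.2%:~R).

Definition dist (S : spatial_domain) (x y : R * R * R) : R :=
  match S with
  | Euclidean => edist x y
  | Torus L => inf [set edist x (translate L%:num y k) | k in setT]
  end.

Definition volume3 := ((@lebesgue_measure R \x @lebesgue_measure R)
                         \x @lebesgue_measure R)%E.

Definition volume4 := (volume3 \x @lebesgue_measure R)%E.

Definition Bset (S : spatial_domain) (x0 : R * R * R) (r : R) : set (R * R * R) :=
  [set x | carrier S x /\ dist S x x0 < r].

Definition Iset (t0 r : R) : set R := `]t0 - r ^+ 2, t0]%classic.

(* Space-time points z = (x, t) are ((x1, x2, x3), t). *)
Definition Qset (S : spatial_domain) (z0 : R * R * R * R) (r : R)
    : set (R * R * R * R) :=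
  Bset S z0.1 r `*` Iset z0.2 r.

End Space.

Section Average.
Variable R : realType.
Local Open Scope ereal_scope.

Definition avg d (X : measurableType d) (mu : {measure set X -> \bar R})
    (E : set X) (f : X -> \bar R) : \bar R :=
  (mu E)^-1 * \int[mu]_(x in E) f x.

(* Entrywise average; meaningful when the entries are integrable on E (fine
   sends infinite values to 0). *)
Definition mxavg d (X : measurableType d) (mu : {measure set X -> \bar R})
    (E : set X) (F : X -> 'M[R]_3) : 'M[R]_3 :=
  (\matrix_(i < 3, j < 3) fine (avg mu E (fun x => (F x i j)%:E)))%R.

End Average.

Section Oscillation.
Variables (R : realType) (N : matrix_norm R) (S : spatial_domain R).
Local Open Scope ereal_scope.

(* Extended-real, so that it is +oo for functions outside C^alpha. *)
Definition Calpha_norm (alpha : R) (f : R * R * R -> 'M[R]_3) : \bar R :=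
  ereal_sup [set (N (f x))%:E | x in carrier S] +
  ereal_sup [set (N (f p.1 - f p.2) / dist S p.1 p.2 `^ alpha)%R%:E | p in
    [set p : (R * R * R) * (R * R * R) |
       [/\ carrier S p.1, carrier S p.2 & p.1 != p.2]]].

Variable M : R -> R * R * R -> 'M[R]_3.

Definition spatial_mean (x0 : R * R * R) (r t : R) : 'M[R]_3 :=
  mxavg (@volume3 R) (Bset S x0 r) (M t).

Definition full_mean (z0 : R * R * R * R) (r : R) : 'M[R]_3 :=
  mxavg (@volume4 R) (Qset S z0 r) (fun z => M z.2 z.1).

Definition osc_full (z0 : R * R * R * R) (r : R) : \bar R :=
  sqrte (avg (@volume4 R) (Qset S z0 r)
    (fun z => (N (M z.2 z.1 - full_mean z0 r) ^+ 2)%R%:E)).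

Definition osc_space (z0 : R * R * R * R) (r : R) : \bar R :=
  sqrte (avg (@lebesgue_measure R) (Iset z0.2 r)
    (fun t => avg (@volume3 R) (Bset S z0.1 r)
      (fun x => (N (M t x - spatial_mean z0.1 r t) ^+ 2)%R%:E))).

Definition osc_time (z0 : R * R * R * R) (r : R) : \bar R :=
  sqrte (avg (@lebesgue_measure R) (Iset z0.2 r)
    (fun t => (N (spatial_mean z0.1 r t - full_mean z0 r) ^+ 2)%R%:E)).

End Oscillation.

(* Main.v *)
Require Import Defs.
From HB Require Import structures.
From mathcomp Require Import all_boot all_order all_algebra.
From mathcomp Require Import all_classical all_reals all_analysis.
From mathcomp Require Import measurable_realfun ring lra.
Set Implicit Arguments.
Unset Strict Implicit.
Unset Printing Implicit Defensive.
Import Order.TTheory GRing.Theory Num.Theory.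
Import numFieldNormedType.Exports.
Local Open Scope classical_set_scope.
Local Open Scope ring_scope.

(* (1) Comparing with the centre, |M(t,x) - m_r(t)| is at most
   |M(t,x) - M(t,x0)| + |M(t,x0) - m_r(t)|, and both terms are at most K r^alpha;
   for the second one, the mean over the ball of a map into a closed norm ball
   stays in that ball, by separation of convex sets. Hence C = 2, whatever the
   norm.

   (2) M is constant in x, so everything reduces to the variance of
   sin(1/(T-t)) over (T-r^2, T]. As sin^2 y = (1 - cos 2y)/2, it is enough that
   the averages of cos(a/(T-t) + b) tend to 0. This holds because
   d/dt [(T-t)^2 sin(a/(T-t) + b)]
     = a cos(a/(T-t) + b) - 2 (T-t) sin(a/(T-t) + b)
   bounds their integral by O(r^4), against r^2 for the length of the interval.
   The values M(T, x) are arbitrary, possibly not measurable in x, so integrals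
   have to be compared off a null set without measurability. *)

(* all_analysis also exports an edist, the extended distance. *)
Local Notation edist := Defs.edist.
(* lebesgue_measure lives on measurableTypeR R, whose measurable structure is not
   syntactically the canonical one of R, although the measurable sets are the
   same. *)
Local Notation space3 R :=
  (measurableTypeR R * measurableTypeR R * measurableTypeR R)%type.
Local Notation space4 R := (space3 R * measurableTypeR R)%type.

(** * Norms on finite-dimensional spaces *)

Section RowNorm.
Variables (R : realType) (n : nat) (p : 'rV[R]_n -> R).
Hypothesis pD : forall u v, p (u + v) <= p u + p v.
Hypothesis pZ : forall a u, p (a *: u) = `|a| * p u.
Hypothesis p_eq0 : forall u, p u = 0 -> u = 0.

Lemma rownorm0 : p 0 = 0.
Proof. by rewrite -(scale0r 0) pZ normr0 mul0r. Qed.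

(** The triangle inequality applied to [u] and [-u], which have the same norm and sum to 0. *)
Lemma rownorm_ge0 u : 0 <= p u.
Proof.
have := pD u ((-1) *: u).
by rewrite pZ normrN1 mul1r scaleN1r subrr rownorm0 -mulr2n pmulrn_lge0.
Qed.

Lemma coord_le_mx_norm (v : 'rV[R]_n) i : `|v 0 i| <= `|v|.
Proof.
rewrite [leRHS]/Num.norm /= mx_normrE.
by apply/bigmax_geP; right; exists (0, i).
Qed.

(** Expand [u] in the standard basis; the constant is the sum of the norms of the basis vectors. *)
Lemma rownorm_le_mx_norm : exists2 C, 0 <= C & forall u, p u <= C * `|u|.
Proof.
exists (\sum_i p (delta_mx 0 i)).
  by apply: sumr_ge0 => i _; exact: rownorm_ge0.
move=> u; rewrite {1}(row_sum_delta u) mulr_suml.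
elim/big_ind2 : _ => [|a b c d ab cd|i _]; first by rewrite rownorm0.
  by rewrite (le_trans (pD _ _))// lerD.
by rewrite pZ mulrC ler_wpM2l ?rownorm_ge0 ?coord_le_mx_norm.
Qed.

Lemma rownorm_continuous : continuous p.
Proof.
have [C C0 pC] := rownorm_le_mx_norm.
suff h (u : 'rV[R]_n) (e : R) : 0 < e -> \forall v \near u, `|p u - p v| <= e.
  by move=> u; apply/(@cvgrPdist_le _ _ _ (nbhs u) (nbhs_filter u)) => e; exact: h.
move=> e0; apply/nbhs_normP; exists (e / (C + 1)) => /=; first by rewrite divr_gt0// ltr_wpDl.
move=> v /= uv.
have h a b : p a - p b <= C * `|a - b|.
  by rewrite (le_trans _ (pC _))// lerBlDr -{1}(subrK b a) pD.
apply: (@le_trans _ _ (C * `|u - v|)).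
  by rewrite ler_norml h andbT lerNl opprB distrC h.
apply: (@le_trans _ _ (C * (e / (C + 1)))).
  by rewrite ler_wpM2l// ltW.
rewrite mulrCA ger_pMr// ler_pdivrMr ?ltr_wpDl//; lra.
Qed.

(** By compactness [p] attains a positive minimum on the unit sphere of the maximum norm;
    homogeneity extends the bound to all vectors. *)
Lemma mx_norm_le_rownorm : exists2 c, 0 <= c & forall u, `|u| <= c * p u.
Proof.
pose S := [set u : 'rV[R]_n | `|u| = 1].
(* The sphere is empty only when every vector is zero ([n = 0]), and then any constant works. *)
have [[u0 Su0]|S0] := pselect (S !=set0); last first.
  exists 0 => // u; rewrite mul0r; have [->|u0] := eqVneq u 0.
    by rewrite normr0.
  exfalso; apply: S0; exists (`|u|^-1 *: u); rewrite /S /=.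
  by rewrite normrZ normfV normr_id mulVf// normr_eq0.
have cS : compact S.
  apply: bounded_closed_compact.
    by exists 1; split=> // x x1 u /= ->; exact: ltW.
  apply: (@closed_comp _ _ (fun u : 'rV[R]_n => `|u|) [set 1]).
    by move=> u _; exact: norm_continuous.
  exact: closed_eq.
have [|v vS vmin] := compact_EVT_min (ex_intro _ u0 Su0) cS (f := p).
  exact/continuous_subspaceT/rownorm_continuous.
have pv0 : 0 < p v.
  rewrite lt_neqAle rownorm_ge0 andbT eq_sym; apply/eqP => /p_eq0 v0.
  by move: vS; rewrite inE /S /= v0 normr0 => /eqP; rewrite eq_sym oner_eq0.
exists (p v)^-1; first by rewrite invr_ge0 ltW.
move=> u; have [->|u_neq0] := eqVneq u 0; first by rewrite rownorm0 normr0 mulr0.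
have := vmin (`|u|^-1 *: u); rewrite inE pZ ger0_norm ?invr_ge0//.
rewrite /S /= normrZ normfV normr_id mulVf ?normr_eq0// => /(_ erefl).
by rewrite ler_pdivlMl ?normr_gt0// mulrC -ler_pdivlMl.
Qed.

(* The Euclidean projection of a onto the compact convex ball {p <= c}
   provides the separating functional. *)
Lemma rownorm_separation (c : R) (a : 'rV[R]_n) : 0 <= c -> c < p a ->
  exists (w : 'rV[R]_n) m,
    (forall x, p x <= c -> \sum_i w 0 i * x 0 i <= m) /\
    m < \sum_i w 0 i * a 0 i.
Proof.
move=> c0 cpa; pose K := [set x | p x <= c].
have [d d0 pd] := mx_norm_le_rownorm.
have cK : compact K.
  apply: bounded_closed_compact.
    exists (d * c); split=> [|x dcx u /= uc]; first exact: num_real.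
    by rewrite (le_trans (pd u))// (le_trans _ (ltW dcx))// ler_wpM2l.
  apply: (@closed_comp _ _ p [set x | x <= c]); last exact: closed_le.
  by move=> u _; exact: rownorm_continuous.
pose q (x : 'rV[R]_n) := \sum_i (a 0 i - x 0 i) ^+ 2.
have cq : continuous q.
  apply: (@continuous_big R 'I_n +%R 0 xpredT add_continuous) => i _ y.
  have cay : {for y, continuous (fun x : 'rV[R]_n => a 0 i - x 0 i)}.
    by apply: continuousB; [exact: cst_continuous|exact: coord_continuous].
  exact: (continuousM cay cay).
have K0 : K !=set0 by exists 0; rewrite /K /= rownorm0.
have [|P] := compact_EVT_min K0 cK (f := q).
  exact: continuous_subspaceT.
rewrite inE /K /= => PK Pmin.
(* The functional is the outward normal at the projection [P] and [m] is its value at [P]; its value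
   at [a] exceeds [m] by the squared distance from [a] to [P]. *)
exists (a - P), (\sum_i (a - P) 0 i * P 0 i); split; last first.
  rewrite -subr_gt0 -sumrB.
  have aP : a != P by apply: contraTneq cpa => ->; rewrite -leNgt.
  have [i aPi] : exists i, a 0 i != P 0 i.
    apply/existsP; apply: contraNT aP => /existsPn h; apply/eqP/rowP => i.
    by apply/eqP; rewrite -[_ == _]negbK h.
  rewrite (bigD1 i)//= ltr_pwDl//.
    by rewrite !mxE -mulrBr -expr2 exprn_even_gt0//= subr_eq0.
  by apply: sumr_ge0 => j _; rewrite !mxE -mulrBr -expr2 sqr_ge0.
(* If the inner product [e] of [a - P] and [x - P] were positive, moving from [P] towards [x] by the
   fraction [s] would change [q] by [- 2 * s * e + s ^+ 2 * D]. With [s = e / (D + e)] one has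
   [s <= 1], so the new point stays in the convex set [K], and [s * D <= e], so [q] drops below its
   minimum. *)
move=> x xc; rewrite -subr_le0 -sumrB leNgt; apply/negP.
set e := (X in 0 < X) => e0.
pose D := \sum_i (x 0 i - P 0 i) ^+ 2.
have D0 : 0 <= D by apply: sumr_ge0 => i _; rewrite sqr_ge0.
pose s := e / (D + e).
have De0 : 0 < D + e by rewrite ltr_wpDl.
have s0 : 0 < s by rewrite divr_gt0.
have s1 : s <= 1 by rewrite ler_pdivrMr// mul1r lerDr.
have pc : p ((1 - s) *: P + s *: x) <= c.
  rewrite (le_trans (pD _ _))// !pZ ger0_norm ?subr_ge0// gtr0_norm//.
  have : (1 - s) * p P <= (1 - s) * c by apply: ler_wpM2l; rewrite ?subr_ge0.
  have : s * p x <= s * c by apply: ler_wpM2l => //; exact: ltW.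
  lra.
have := Pmin ((1 - s) *: P + s *: x); rewrite inE => /(_ pc).
apply/negP; rewrite -ltNge.
suff -> : q ((1 - s) *: P + s *: x) = q P - 2 * s * e + s ^+ 2 * D.
  rewrite -addrA gtrDl.
  have -> : - (2 * s * e) + s ^+ 2 * D = s * (s * D - 2 * e) by ring.
  rewrite pmulr_rlt0// subr_lt0.
  have : s * D <= e.
    rewrite /s mulrAC ler_pdivrMr// ler_wpM2l ?ltW//.
    by rewrite ltrDl.
  by move: e0; lra.
rewrite /q /e /D !mulr_sumr -sumrN -!big_split/=.
by apply: eq_bigr => i _; rewrite !mxE; ring.
Qed.

End RowNorm.

Section MatrixNorm.
Variables (R : realType) (N : matrix_norm R).

Let p (v : 'rV[R]_(3 * 3)) := N (vec_mx v).

Let pD u v : p (u + v) <= p u + p v.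
Proof. by rewrite /p linearD mxnormD. Qed.

Let pZ a u : p (a *: u) = `|a| * p u.
Proof. by rewrite /p linearZ mxnormZ. Qed.

Let p_eq0 u : p u = 0 -> u = 0.
Proof.
by move=> /mxnorm_eq0 u0; rewrite -[u]vec_mxK u0 linear0.
Qed.

Lemma mxnorm0 : N 0 = 0.
Proof. by have := rownorm0 pZ; rewrite /p linear0. Qed.

Lemma mxnorm_ge0 A : 0 <= N A.
Proof. by have := rownorm_ge0 pD pZ (mxvec A); rewrite /p mxvecK. Qed.

Lemma mxnormB A B : N (A - B) = N (B - A).
Proof. by rewrite -opprB -scaleN1r mxnormZ normrN1 mul1r. Qed.

(** The constant depends on [N]; it serves only the measurability and integrability of entries and
    does not enter the final bound. *)
Lemma entry_le_mxnorm :
  exists2 c, 0 <= c & forall (A : 'M[R]_3) i j, `|A i j| <= c * N A.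
Proof.
have [c c0 h] := mx_norm_le_rownorm pD pZ p_eq0; exists c => // A i j.
have := h (mxvec A); rewrite /p mxvecK; apply: le_trans.
by rewrite -(mxvecE A i j) coord_le_mx_norm.
Qed.

Lemma mxnorm_separation (c : R) (A : 'M[R]_3) : 0 <= c -> c < N A ->
  exists (W : 'M[R]_3) m,
    (forall X, N X <= c -> \sum_i \sum_j W i j * X i j <= m) /\
    m < \sum_i \sum_j W i j * A i j.
Proof.
move=> c0 cA; have := @rownorm_separation _ _ p pD pZ p_eq0 c (mxvec A) c0.
rewrite /p mxvecK => /(_ cA)[w [m [wm mw]]].
have E (X : 'M[R]_3) :
    \sum_i \sum_j vec_mx w i j * X i j = \sum_k w 0 k * mxvec X 0 k.
  rewrite pair_big/= (reindex (uncurry (@mxvec_index 3 3)))/=; last first.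
    by case: (curry_mxvec_bij 3 3) => g gK Kg; exists g => x _; [exact: gK|exact: Kg].
  by apply: eq_bigr => -[i j] _ /=; rewrite mxvecE mxE.
exists (vec_mx w), m; rewrite E; split=> // X Xc.
by rewrite E wm// mxvecK.
Qed.

End MatrixNorm.

(** * Averages and null sets *)

Section Averages.
Context d (X : measurableType d) (R : realType) (mu : {measure set X -> \bar R}).
Variable E : set X.
Hypotheses (mE : measurable E) (E_gt0 : (0 < mu E)%E) (E_ltoo : (mu E < +oo)%E).

(** Real-valued version of [avg], on which linearity is plain ring algebra; [avg_EFin] identifies
    the two on integrable functions. *)
Definition ravg (f : X -> R) : R :=
  (fine (mu E))^-1 * Rintegral mu E f.

Lemma fine_measure_gt0 : 0 < fine (mu E).
Proof. by rewrite fine_gt0// E_gt0 E_ltoo. Qed.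

Let muE : mu E = (fine (mu E))%:E.
Proof. by rewrite fineK// ge0_fin_numE. Qed.

Lemma inve_measure : ((mu E)^-1)%E = ((fine (mu E))^-1)%:E.
Proof. by rewrite muE inver gt_eqF//= fine_measure_gt0. Qed.

Lemma bounded_integrable (f : X -> R) (c : R) : measurable_fun E f ->
  (forall x, E x -> `|f x| <= c) -> mu.-integrable E (EFin \o f).
Proof.
move=> mf fc; apply: measurable_bounded_integrable => //.
exists c; split=> [|y cy x /= /fc/le_trans]; first exact: num_real.
by apply; exact: ltW.
Qed.

Lemma normr_Rintegral_le (f : X -> R) (c : R) : measurable_fun E f ->
  (forall x, E x -> `|f x| <= c) -> `|Rintegral mu E f| <= c * fine (mu E).
Proof.
move=> mf fc; have If := bounded_integrable mf fc.
rewrite (le_trans (le_normr_Rintegral mE If))// -Rintegral_cst//.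
apply: le_Rintegral => //; first exact: integrable_norm.
exact: (@bounded_integrable _ `|c|).
Qed.

Lemma avg_EFin (f : X -> R) : mu.-integrable E (EFin \o f) ->
  avg mu E (fun x => (f x)%:E) = (ravg f)%:E.
Proof.
move=> If; rewrite /avg inve_measure EFinM /Rintegral fineK//.
exact: integrable_fin_num.
Qed.

Lemma mxavgE (F : X -> 'M[R]_3) i j :
  mu.-integrable E (fun x => (F x i j)%:E) ->
  mxavg mu E F i j = ravg (fun x => F x i j).
Proof. by move=> IF; rewrite mxE avg_EFin. Qed.

Lemma ravg_cst c : ravg (fun=> c) = c.
Proof.
by rewrite /ravg Rintegral_cst// mulrCA mulVf ?mulr1// gt_eqF// fine_measure_gt0.
Qed.

Lemma ravgD f g : mu.-integrable E (EFin \o f) -> mu.-integrable E (EFin \o g) ->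
  ravg (fun x => f x + g x) = ravg f + ravg g.
Proof. by move=> If Ig; rewrite /ravg RintegralD// mulrDr. Qed.

Lemma ravgZ c f : mu.-integrable E (EFin \o f) ->
  ravg (fun x => c * f x) = c * ravg f.
Proof. by move=> If; rewrite /ravg RintegralZl// mulrCA. Qed.

(** Integrability of the partial sums is proved along with the formula because the induction step
    needs it. *)
Lemma ravg_sum (I : Type) (r : seq I) (f : I -> X -> R) :
  (forall i, mu.-integrable E (EFin \o f i)) ->
  mu.-integrable E (EFin \o (fun x => \sum_(i <- r) f i x)) /\
  ravg (fun x => \sum_(i <- r) f i x) = \sum_(i <- r) ravg (f i).
Proof.
move=> If; elim: r => [|i r [IHi IHr]].
  rewrite big_nil; under [X in ravg X]funext => x do rewrite big_nil.
  rewrite ravg_cst; split=> //.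
  rewrite (_ : _ \o _ = cst 0%E); first exact: integrable0.
  by apply/funext => x /=; rewrite big_nil.
rewrite big_cons; under [X in ravg X]funext => x do rewrite big_cons.
rewrite ravgD// IHr; split=> //.
rewrite (_ : _ \o _ = (fun x => (f i x)%:E + (\sum_(i <- r) f i x)%:E)%E).
  exact: (integrableD mE (If i) IHi).
by apply/funext => x /=; rewrite big_cons.
Qed.

Lemma le_ravg f g : mu.-integrable E (EFin \o f) -> mu.-integrable E (EFin \o g) ->
  (forall x, E x -> f x <= g x) -> ravg f <= ravg g.
Proof.
by move=> If Ig fg; rewrite ler_wpM2l ?le_Rintegral.
Qed.

(** A linear functional commutes with the entrywise average, so one bounded by [m] on the ball is
    bounded by [m] at the averaged matrix as well and cannot separate it. No comparison of [N] with
    the entries is used, hence no constant is lost. *)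
Lemma mxavg_dist_le (N : matrix_norm R) (F : X -> 'M[R]_3) (A : 'M[R]_3) (c : R) :
  0 <= c -> (forall i j, mu.-integrable E (fun x => (F x i j)%:E)) ->
  (forall x, E x -> N (A - F x) <= c) -> N (A - mxavg mu E F) <= c.
Proof.
move=> c0 IF NF; rewrite leNgt; apply/negP => /(mxnorm_separation c0)[W [m [Wm]]].
apply/negP; rewrite -leNgt.
have IWF i j : mu.-integrable E (EFin \o (fun x => W i j * F x i j)).
  rewrite (_ : _ \o _ = (fun x => (W i j)%:E * (F x i j)%:E)%E); last first.
    by apply/funext => x /=; rewrite EFinM.
  exact: integrableZl.
have IWFi i := ravg_sum (index_enum 'I_3) (fun j => IWF i j).
have [IS avgS] := ravg_sum (index_enum 'I_3) (fun i => (IWFi i).1).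
rewrite (_ : \sum_i _ = \sum_i \sum_j W i j * A i j -
    \sum_i \sum_j W i j * mxavg mu E F i j); last first.
  rewrite -sumrB; apply: eq_bigr => i _; rewrite -sumrB.
  by apply: eq_bigr => j _; rewrite !mxE mulrBr.
set a := \sum_i \sum_j _; rewrite lerBlDl -lerBlDr.
have -> : \sum_i \sum_j W i j * mxavg mu E F i j =
    ravg (fun x => \sum_i \sum_j W i j * F x i j).
  rewrite avgS; apply: eq_bigr => i _; rewrite (IWFi i).2.
  by apply: eq_bigr => j _; rewrite mxavgE// ravgZ//; exact: IF.
rewrite -[leLHS]ravg_cst; apply: le_ravg => //.
  by apply: (@bounded_integrable _ `|a - m|).
move=> x Ex; rewrite lerBlDr -lerBlDl; apply: le_trans (Wm _ (NF _ Ex)).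
rewrite /a -sumrB; apply: ler_sum => i _; rewrite -sumrB; apply: ler_sum => j _.
by rewrite !mxE mulrBr.
Qed.

End Averages.

Section NullSets.
Context d (X : measurableType d) (R : realType) (mu : {measure set X -> \bar R}).
Variables D : set X.
Hypothesis mD : measurable D.
Local Open Scope ereal_scope.

(* Unlike the library's ge0_le_integral, no measurability is assumed. *)
Lemma ge0_le_integral_nonmeasurable (f g : X -> \bar R) :
  (forall x, D x -> 0 <= f x) -> (forall x, D x -> f x <= g x) ->
  \int[mu]_(x in D) f x <= \int[mu]_(x in D) g x.
Proof.
move=> f0 fg; have g0 x : D x -> 0 <= g x.
  by move=> Dx; exact: le_trans (f0 _ Dx) (fg _ Dx).
rewrite !ge0_integralE//=; apply: ge_ereal_sup => _ [h hf <-].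
apply: ereal_sup_ubound; exists h => // x /=; apply: (le_trans (hf x)).
by rewrite !patchE; case: ifPn => // /set_mem; exact: fg.
Qed.

Lemma integral_le_cst (f : X -> \bar R) c : (forall x, D x -> 0 <= f x <= c) ->
  \int[mu]_(x in D) f x <= c * mu D.
Proof.
move=> fc; rewrite -integral_cst//.
by apply: ge0_le_integral_nonmeasurable => x /fc/andP[].
Qed.

Lemma avg_ge0 (f : X -> \bar R) : (forall x, D x -> 0 <= f x) -> 0 <= avg mu D f.
Proof. by move=> f0; rewrite mule_ge0 ?inve_ge0 ?integral_ge0. Qed.

(** Stated for arbitrary [f] because in [osc_space] the outer integrand depends on [t] through a
    field with no assumed regularity in time. *)
Lemma avg_le_cst (f : X -> \bar R) (c : R) : 0 < mu D -> mu D < +oo ->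
  (forall x, D x -> 0 <= f x <= c%:E) -> avg mu D f <= c%:E.
Proof.
move=> D0 Doo fc; rewrite /avg inve_measure// lee_pdivrMl ?fine_measure_gt0//.
by rewrite fineK ?ge0_fin_numE// muleC integral_le_cst.
Qed.

Variable Z : set X.
Hypotheses (mZ : measurable Z) (Z0 : mu Z = 0).

Lemma ge0_eq_integral_off_null (f g : X -> \bar R) :
  (forall x, D x -> 0 <= f x) -> (forall x, D x -> 0 <= g x) ->
  measurable_fun D g -> (forall x, D x -> ~ Z x -> f x = g x) ->
  \int[mu]_(x in D) f x = \int[mu]_(x in D) g x.
Proof.
move=> f0 g0 mg fg; apply/eqP; rewrite eq_le; apply/andP; split.
  (* First inequality: [f] is dominated by [g] plus the function equal to [+oo] on [Z], whose
     integral vanishes since [Z] is null. *)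
  have Zoo0 x : 0 <= ((cst +oo : X -> \bar R) \_ Z) x.
    by rewrite patchE; case: ifPn => // _; rewrite leey.
  apply: (@le_trans _ _ (\int[mu]_(x in D) (g x + ((cst +oo) \_ Z) x))).
    apply: ge0_le_integral_nonmeasurable => // x Dx.
    have [Zx|Zx] := pselect (Z x).
      by rewrite patchE mem_set//= addey ?leey// -ltNye (lt_le_trans _ (g0 _ Dx)).
    by rewrite fg// leeDl.
  rewrite ge0_integralD//; last first.
    by apply/measurable_restrict => //; exact: measurable_cst.
  rewrite -integral_mkcondr integral_cst; last exact: measurableI.
  rewrite (_ : mu _ = 0) ?mule0 ?adde0//.
  by apply: (subset_measure0 _ _ _ Z0) => //; exact: measurableI.
(* Reverse inequality: discard [Z] from the integral of the measurable [g]; what remains is the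
   integral of [f] over a smaller set. *)
rewrite (ge0_negligible_integral mZ)//.
rewrite (@eq_integral _ _ _ _ _ f); last first.
  by move=> x; rewrite inE => -[Dx Zx]; rewrite fg.
rewrite setDE integral_mkcondr; apply: ge0_le_integral_nonmeasurable => x Dx.
  by rewrite patchE; case: ifPn => // _; exact: f0.
by rewrite patchE; case: ifPn => // _; exact: f0.
Qed.

Lemma eq_integral_off_null (f g : X -> \bar R) : measurable_fun D g ->
  (forall x, D x -> ~ Z x -> f x = g x) ->
  \int[mu]_(x in D) f x = \int[mu]_(x in D) g x.
Proof.
move=> mg fg; rewrite integralE [RHS]integralE; congr (_ - _).
  apply: ge0_eq_integral_off_null => //; first exact: measurable_funepos.
  by move=> x Dx Zx; rewrite !funeposE fg.
apply: ge0_eq_integral_off_null => //; first exact: measurable_funeneg.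
by move=> x Dx Zx; rewrite !funenegE fg.
Qed.

Lemma eq_avg_off_null (f g : X -> \bar R) : measurable_fun D g ->
  (forall x, D x -> ~ Z x -> f x = g x) -> avg mu D f = avg mu D g.
Proof. by move=> mg fg; rewrite /avg (eq_integral_off_null mg fg). Qed.

End NullSets.

(** * Fields equal to a scalar function times a fixed matrix off a null set *)

Section RankOne.
Context d (X : measurableType d) (R : realType) (mu : {measure set X -> \bar R}).
Variables E Z : set X.
Hypotheses (mE : measurable E) (E_gt0 : (0 < mu E)%E) (E_ltoo : (mu E < +oo)%E).
Hypotheses (mZ : measurable Z) (Z0 : mu Z = 0%E).
Variables (g : X -> R) (c : R) (B : 'M[R]_3) (F : X -> 'M[R]_3).
Hypotheses (mg : measurable_fun E g) (gc : forall x, E x -> `|g x| <= c).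
Hypothesis FB : forall x, E x -> ~ Z x -> F x = g x *: B.

Let Ig : mu.-integrable E (EFin \o g).
Proof. exact: bounded_integrable mg gc. Qed.

Let Ig2 : mu.-integrable E (EFin \o (fun x => g x ^+ 2)).
Proof.
apply: (@bounded_integrable _ _ _ _ _ _ _ _ (c ^+ 2)) => //.
  exact: measurable_funX.
move=> x Ex; rewrite normrX lerXn2r ?nnegrE// ?gc//.
by apply: le_trans (gc Ex).
Qed.

Lemma mxavg_rank1 : mxavg mu E F = ravg mu E g *: B.
Proof.
apply/matrixP => i j; rewrite !mxE.
rewrite (@eq_avg_off_null _ _ _ _ _ mE Z mZ Z0 _ (fun x => (B i j * g x)%:E)).
- rewrite avg_EFin// ?ravgZ//= 1?mulrC//.
  rewrite (_ : _ \o _ = (fun x => (B i j)%:E * (g x)%:E)%E); last first.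
    by apply/funext => x /=; rewrite EFinM.
  exact: integrableZl.
- by apply/measurable_EFinP; exact: measurable_funM.
- by move=> x Ex Zx; rewrite FB// mxE mulrC.
Qed.

(** By homogeneity the integrand is [(g x - s) ^+ 2 * N B ^+ 2] off [Z]. When [s] is the mean of
    [g], the first factor on the right is the variance of [g]. *)
Lemma avg_sqr_rank1 (N : matrix_norm R) s :
  avg mu E (fun x => (N (F x - s *: B) ^+ 2)%:E) =
  ((ravg mu E (fun x => g x ^+ 2) - 2 * s * ravg mu E g + s ^+ 2) * N B ^+ 2)%:E.
Proof.
pose h x := N B ^+ 2 * (g x ^+ 2 + (- (2 * s) * g x + s ^+ 2)).
have Ilin : mu.-integrable E (EFin \o (fun x => - (2 * s) * g x)).
  apply: (@bounded_integrable _ _ _ _ _ _ _ _ (`|- (2 * s)| * c)) => //.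
    exact: measurable_funM.
  by move=> x Ex; rewrite normrM ler_wpM2l// gc.
have Ics : mu.-integrable E (EFin \o (fun=> s ^+ 2)).
  exact: (@bounded_integrable _ _ _ _ _ _ _ _ `|s ^+ 2|).
have Iaff : mu.-integrable E (EFin \o (fun x => - (2 * s) * g x + s ^+ 2)).
  exact: (integrableD mE Ilin Ics).
have Iq : mu.-integrable E
    (EFin \o (fun x => g x ^+ 2 + (- (2 * s) * g x + s ^+ 2))).
  exact: (integrableD mE Ig2 Iaff).
have Ih : mu.-integrable E (EFin \o h).
  exact: (integrableZl mE (N B ^+ 2) Iq).
rewrite (@eq_avg_off_null _ _ _ _ _ mE Z mZ Z0 _ (EFin \o h)).
- rewrite avg_EFin// /h ravgZ// !ravgD// ravg_cst// ravgZ//.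
  by congr EFin; ring.
- exact: measurable_int Ih.
- move=> x Ex Zx; rewrite FB// -scalerBl mxnormZ exprMn real_normK ?num_real//=.
  by rewrite /h; congr EFin; ring.
Qed.

End RankOne.

(** * Balls in the Euclidean space and in the torus *)

Section Geometry.
Variable R : realType.
Implicit Types (S : spatial_domain R) (x y : R * R * R).

Lemma edist_ge0 x y : 0 <= edist x y.
Proof. exact: sqrtr_ge0. Qed.

Lemma coord_le_edist x y :
  [/\ `|x.1.1 - y.1.1| <= edist x y, `|x.1.2 - y.1.2| <= edist x y
    & `|x.2 - y.2| <= edist x y].
Proof.
have h (a b : R) : 0 <= b -> `|a| <= Num.sqrt (a ^+ 2 + b).
  by move=> b0; rewrite -sqrtr_sqr ler_wsqrtr// lerDl.
split; rewrite /edist.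
- by rewrite -addrA h// addr_ge0// sqr_ge0.
- by rewrite [X in Num.sqrt X]addrAC [X in Num.sqrt X]addrC h// addr_ge0// sqr_ge0.
- by rewrite [X in Num.sqrt X]addrC h// addr_ge0// sqr_ge0.
Qed.

Lemma edist_le_sum x y :
  edist x y <= `|x.1.1 - y.1.1| + `|x.1.2 - y.1.2| + `|x.2 - y.2|.
Proof.
rewrite -[leRHS]ger0_norm ?addr_ge0// -sqrtr_sqr ler_wsqrtr//.
rewrite -!(real_normK (num_real (_ - _))).
move: (normr_ge0 (x.1.1 - y.1.1)) (normr_ge0 (x.1.2 - y.1.2)).
move: (normr_ge0 (x.2 - y.2)).
set a := `|_|; set b := `|_|; set c := `|_| => a0 b0 c0.
have := mulr_ge0 a0 b0; have := mulr_ge0 a0 c0; have := mulr_ge0 b0 c0; nra.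
Qed.

Lemma translate0 L x : translate L x (0, 0, 0) = x.
Proof. by case: x => -[a b] c; rewrite /translate/= !mulr0 !addr0. Qed.

Lemma dist_le_edist S x y : dist S x y <= edist x y.
Proof.
case: S => [|L]//=; apply: ge_inf; last first.
  by exists (0, 0, 0) => //; rewrite translate0.
by exists 0 => _ [k _ <-]; exact: edist_ge0.
Qed.

Lemma dist_ge0 S x y : 0 <= dist S x y.
Proof.
case: S => [|L] /=; first exact: edist_ge0.
apply: lb_le_inf; first by exists (edist x (translate L%:num y (0, 0, 0))); exists (0, 0, 0).
by move=> _ [k _ <-]; exact: edist_ge0.
Qed.

(** Replacing the infimum by an existential exhibits a torus ball as a countable union of Euclidean
    balls, which makes it measurable. *)
Lemma dist_Torus_lt (L : {posnum R}) x y r :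
  dist (Torus L) x y < r <-> exists k, edist x (translate L%:num y k) < r.
Proof.
split=> [/inf_lt[]|[k kr]].
- by exists (edist x (translate L%:num y (0, 0, 0))); exists (0, 0, 0).
- by move=> _ [k _ <-]; exists k.
- apply: le_lt_trans kr; apply: ge_inf; last by exists k.
  by exists 0 => _ [j _ <-]; exact: edist_ge0.
Qed.

(** For [k = 0] the distance is [|a - b|]; any other shift has length at least [L], leaving at least
    [L - |a - b|]. Uniformity in [k] keeps the infimum over the lattice positive. *)
Lemma torus_coord_gap (L a b : R) : 0 <= a < L -> 0 <= b < L -> a != b ->
  exists2 e, 0 < e & forall k : int, e <= `|a - (b + L * k%:~R)|.
Proof.
move=> /andP[a0 aL] /andP[b0 bL] ab.
have d0 : 0 < `|a - b| by rewrite normr_gt0 subr_eq0.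
have dL : `|a - b| < L by rewrite ltr_norml; apply/andP; split; lra.
have L0 : 0 < L by lra.
exists (Num.min `|a - b| (L - `|a - b|)); first by rewrite lt_min d0 subr_gt0.
move=> k; have [->|k0] := eqVneq k 0; first by rewrite mulr0 addr0 ge_min lexx.
rewrite ge_min; apply/orP; right.
have : L <= `|L * k%:~R|.
  rewrite normrM gtr0_norm// ler_peMr ?(ltW L0)// -intr_norm ler1z.
  by rewrite -gtz0_ge1 normr_gt0.
move=> Lk; rewrite opprD addrA [leRHS]distrC.
by apply: le_trans (lerB_dist _ _); rewrite lerD2r.
Qed.

(** Guarantees a nonzero denominator in the Hölder quotients of [Calpha_norm]. On the torus, one
    differing coordinate suffices. *)
Lemma dist_gt0 S x y : carrier S x -> carrier S y -> x != y -> 0 < dist S x y.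
Proof.
case: S => [|L] /=.
  move=> _ _ xy; have [h1 h2 h3] := coord_le_edist x y.
  rewrite lt_neqAle edist_ge0 andbT; apply: contra_neq xy => d0.
  rewrite -d0 !normr_le0 !subr_eq0 in h1 h2 h3.
  by case: x y h1 h2 h3 {d0} => [[a b] c] [[a' b'] c'] /= /eqP-> /eqP-> /eqP->.
move=> [x1 x2 x3] [y1 y2 y3] xy.
suff [e e0 he] : exists2 e, 0 < e &
    forall k, e <= edist x (translate L%:num y k).
  apply: (lt_le_trans e0); apply: lb_le_inf; last by move=> _ [k _ <-]; exact: he.
  by exists (edist x (translate L%:num y (0, 0, 0))); exists (0, 0, 0).
have [e1|e1] := eqVneq x.1.1 y.1.1; last first.
  have [e e0 he] := torus_coord_gap x1 y1 e1; exists e => // k.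
  by have [h _ _] := coord_le_edist x (translate L%:num y k); exact: le_trans (he k.1.1) h.
have [e2|e2] := eqVneq x.1.2 y.1.2; last first.
  have [e e0 he] := torus_coord_gap x2 y2 e2; exists e => // k.
  by have [_ h _] := coord_le_edist x (translate L%:num y k); exact: le_trans (he k.1.2) h.
have [e3|e3] := eqVneq x.2 y.2; last first.
  have [e e0 he] := torus_coord_gap x3 y3 e3; exists e => // k.
  by have [_ _ h] := coord_le_edist x (translate L%:num y k); exact: le_trans (he k.2) h.
exfalso; move/eqP: xy; apply.
by case: x y e1 e2 e3 {x1 x2 x3 y1 y2 y3} => [[a b] c] [[a' b'] c'] /= -> -> ->.
Qed.

Definition box (I J K : interval R) : set (R * R * R) :=
  ([set` I] `*` [set` J]) `*` [set` K].

Lemma measurable_box I J K : measurable (box I J K).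
Proof. by apply: measurableX => //; apply: measurableX. Qed.

Lemma volume3_box I J K :
  @volume3 R (box I J K) = (lebesgue_measure ([set` I] : set R) *
    lebesgue_measure ([set` J] : set R) * lebesgue_measure ([set` K] : set R))%E.
Proof.
rewrite /volume3 /box product_measure1E//=; last exact: measurableX.
by rewrite product_measure1E.
Qed.

Lemma measurable_edist_ball y r : measurable [set x | edist x y < r].
Proof.
have mf : measurable_fun setT (fun x => edist x y).
  apply: measurableT_comp.
    by apply: continuous_measurable_fun; exact: sqrt_continuous.
  by do 2?apply: measurable_funD; apply: measurable_funX;
    apply: measurable_funB => //; apply: measurableT_comp.
have := mf measurableT `]-oo, r[%classic (measurable_itv _).
by rewrite setTI; congr measurable.
Qed.

Lemma measurable_carrier S : measurable (carrier S).
Proof.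
case: S => [|L] /=; first exact: measurableT.
rewrite (_ : [set x | _] = box `[0, L%:num[ `[0, L%:num[ `[0, L%:num[).
  exact: measurable_box.
apply/seteqP; split=> x /=; rewrite /box /=.
  by move=> [? ? ?]; rewrite !in_itv.
by rewrite !in_itv/= => -[[? ?] ?].
Qed.

Lemma measurable_Bset S x0 r : measurable (Bset S x0 r : set (space3 R)).
Proof.
suff mS : measurable [set x | dist S x x0 < r].
  exact: (measurableI _ _ (measurable_carrier S) mS).
case: S => [|L]; first exact: measurable_edist_ball.
rewrite (_ : [set x | _] =
    \bigcup_k [set x | edist x (translate L%:num x0 k) < r]).
  by apply: countable_bigcupT_measurable => // k; exact: measurable_edist_ball.
apply/seteqP; split=> x /= => [/dist_Torus_lt[k kr]|[k _ kr]].
  by exists k.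
by apply/dist_Torus_lt; exists k.
Qed.

Lemma Bset_ltoo S x0 r : (@volume3 R (Bset S x0 r) < +oo)%E.
Proof.
suff [I [J [K [sub [Ioo Joo Koo]]]]] : exists I J K,
    Bset S x0 r `<=` box I J K /\
    [/\ (lebesgue_measure ([set` I] : set R) < +oo)%E,
       (lebesgue_measure ([set` J] : set R) < +oo)%E &
       (lebesgue_measure ([set` K] : set R) < +oo)%E].
  apply: (@le_lt_trans _ _ (@volume3 R (box I J K))).
    apply: le_measure => //; rewrite inE.
      exact: measurable_Bset.
    exact: measurable_box.
  by rewrite volume3_box !lte_mul_pinfty ?mule_ge0// ge0_fin_numE ?mule_ge0//
    lte_mul_pinfty// ge0_fin_numE.
have bnd (a b : R) : (lebesgue_measure (`[a, b]%classic : set R) < +oo)%E.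
  by rewrite lebesgue_measure_itv/=; case: ifP => _; rewrite -?EFinB ltry.
case: S => [|L].
  exists `[x0.1.1 - r, x0.1.1 + r], `[x0.1.2 - r, x0.1.2 + r],
    `[x0.2 - r, x0.2 + r]; split; last by split; exact: bnd.
  move=> x [_ /=] xr; have [h1 h2 h3] := coord_le_edist x x0.
  rewrite /box/= !in_itv/= -!ler_distl; split; first split.
  - exact: ltW (le_lt_trans h1 xr).
  - exact: ltW (le_lt_trans h2 xr).
  - exact: ltW (le_lt_trans h3 xr).
exists `[0, L%:num], `[0, L%:num], `[0, L%:num]; split; last by split; exact: bnd.
move=> x [/= [/andP[? ?] /andP[? ?] /andP[? ?]] _].
by rewrite /box/= !in_itv/=; split; [split|]; apply/andP; split=> //; exact: ltW.
Qed.

Lemma Bset_center S x0 r : carrier S x0 -> 0 < r -> Bset S x0 r x0.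
Proof.
move=> x0S r0; split=> //; apply: le_lt_trans (dist_le_edist _ _ _) _.
by rewrite /edist !subrr expr0n/= !addr0 sqrtr0.
Qed.

(** The ball contains a small half-open box with lower corner [x0]. Only increasing directions are
    used, since on the torus [x0] may lie on a face of [[0, L)^3]. *)
Lemma Bset_gt0 S x0 r : carrier S x0 -> 0 < r -> (0 < @volume3 R (Bset S x0 r))%E.
Proof.
move=> x0S r0.
suff [e e0 sub] : exists2 e : R, 0 < e &
    box `[x0.1.1, x0.1.1 + e[ `[x0.1.2, x0.1.2 + e[ `[x0.2, x0.2 + e[ `<=`
    Bset S x0 r.
  apply: (@lt_le_trans _ _ (e * e * e)%:E); first by rewrite lte_fin !mulr_gt0.
  apply: (@le_trans _ _ (@volume3 R (box `[x0.1.1, x0.1.1 + e[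
      `[x0.1.2, x0.1.2 + e[ `[x0.2, x0.2 + e[))); last first.
    apply: le_measure => //; rewrite inE.
      exact: measurable_box.
    exact: measurable_Bset.
  rewrite volume3_box !lebesgue_measure_itv/= !lte_fin !ltrDl e0.
  by rewrite -!EFinB -!EFinM lee_fin !(addrC _ e) !addrK.
suff [e e0 sub] : exists2 e : R, 0 < e &
    forall x, box `[x0.1.1, x0.1.1 + e[ `[x0.1.2, x0.1.2 + e[ `[x0.2, x0.2 + e[ x ->
    carrier S x.
  (* Three coordinate increments below [r / 3] give a Euclidean distance below [r]. *)
  exists (Num.min e (r / 3)); first by rewrite lt_min e0 divr_gt0.
  move=> x; rewrite /box/= !in_itv/= => -[[/andP[a1 a2] /andP[b1 b2]] /andP[c1 c2]].
  have := ge_min e e (r / 3); have := ge_min (r / 3) e (r / 3).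
  rewrite !lexx orbT/=; move: (Num.min _ _) a2 b2 c2 => m a2 b2 c2 mr me.
  split.
    apply: sub; rewrite /box/= !in_itv/= a1 b1 c1/=; split; first split.
    - by apply: (lt_le_trans a2); rewrite lerD2l.
    - by apply: (lt_le_trans b2); rewrite lerD2l.
    - by apply: (lt_le_trans c2); rewrite lerD2l.
  apply: le_lt_trans (dist_le_edist _ _ _) _.
  apply: le_lt_trans (edist_le_sum _ _) _.
  by rewrite !ger0_norm ?subr_ge0//; lra.
case: S x0S => [|L] /=; first by exists 1.
move=> [/andP[a1 a2] /andP[b1 b2] /andP[c1 c2]].
exists (Num.min (L%:num - x0.1.1) (Num.min (L%:num - x0.1.2) (L%:num - x0.2))).
  by rewrite !lt_min !subr_gt0 a2 b2.
move=> x; rewrite /box/= !in_itv/= => -[[/andP[a3 a4] /andP[b3 b4]] /andP[c3 c4]].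
rewrite (le_trans a1)// (le_trans b1)// (le_trans c1)//=; split.
- by rewrite (lt_le_trans a4)// -lerBrDl ge_min lexx.
- by rewrite (lt_le_trans b4)// -lerBrDl !ge_min lexx ?orbT.
- by rewrite (lt_le_trans c4)// -lerBrDl !ge_min lexx ?orbT.
Qed.

(* The rational boxes form a countable base, which gives measurability of
   continuous functions for the product sigma-algebra. *)
Lemma continuous_measurable_fun3 (E : set (space3 R)) (f : space3 R -> R) :
  (forall x, E x -> forall e, 0 < e -> exists2 d, 0 < d & forall y, E y ->
     `|y.1.1 - x.1.1| < d -> `|y.1.2 - x.1.2| < d -> `|y.2 - x.2| < d ->
     `|f y - f x| < e) ->
  measurable_fun E f.
Proof.
move=> cf mE; apply: (measurability _ (RGenOInfty.measurableE R)) => // _ [_ [a ->] <-].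
pose bx (k : (rat * rat) * (rat * rat) * (rat * rat)) :=
  box `]ratr k.1.1.1, ratr k.1.1.2[ `]ratr k.1.2.1, ratr k.1.2.2[
      `]ratr k.2.1, ratr k.2.2[.
(* Keep the boxes on whose trace on [E] the function exceeds [a]; their union cuts out the
   superlevel set. *)
pose good k := forall x, E x -> bx k x -> a < f x.
rewrite (_ : _ `&` _ = E `&` \bigcup_k (if `[< good k >] then bx k else set0)).
  apply: measurableI => //; apply: countable_bigcupT_measurable => // k.
  by case: ifP => // _; exact: measurable_box.
apply/seteqP; split=> x /=; rewrite in_itv/= andbT; last first.
  move=> [Ex [k _]]; case: ifPn => // /asboolP gk xk; split=> //; exact: gk.
move=> [Ex afx]; split=> //.
have [d d0 fd] := cf x Ex (f x - a) ltac:(by rewrite subr_gt0).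
have ratI (c : R) : exists p q : rat, [/\ ratr p < c, c < ratr q,
    c - d < ratr p & ratr q < c + d].
  have [|p] := @rat_in_itvoo R (c - d) c; first by rewrite ltrBlDr ltrDl.
  have [|q] := @rat_in_itvoo R c (c + d); first by rewrite ltrDl.
  by rewrite !in_itv/= => /andP[? ?] /andP[? ?]; exists p, q.
have [p1 [q1 [? ? ? ?]]] := ratI x.1.1.
have [p2 [q2 [? ? ? ?]]] := ratI x.1.2.
have [p3 [q3 [? ? ? ?]]] := ratI x.2.
exists ((p1, q1), (p2, q2), (p3, q3)) => //; case: ifPn => [_|/asboolPn[]].
  by rewrite /bx /box/= !in_itv/=; split; [split|]; apply/andP.
move=> y Ey; rewrite /bx /box/= !in_itv/= => -[[/andP[? ?] /andP[? ?]] /andP[? ?]].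
have close (c z p q : R) : c - d < p -> p < z -> z < q -> q < c + d -> `|z - c| < d.
  move=> cp pz zq qc; rewrite ltr_distl.
  by rewrite (lt_trans cp pz) (lt_trans zq qc).
suff : `|f y - f x| < f x - a by rewrite ltr_distl subKr => /andP[].
by apply: fd => //; [exact: (close _ _ (ratr p1) (ratr q1))|
  exact: (close _ _ (ratr p2) (ratr q2))|exact: (close _ _ (ratr p3) (ratr q3))].
Qed.

End Geometry.

(** * Averages of rapidly oscillating functions *)

Section Oscillation.
Variable R : realType.

(** Split at the singularity: the inverse is continuous on the open complement of 0, and every
    function is measurable on a singleton. *)
Lemma measurable_inv : measurable_fun setT (@GRing.inv R).
Proof.
rewrite -(setvU [set 0]); apply/measurable_funU => //; first exact: measurableC.
split; last exact: measurable_fun_set1.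
apply: open_continuous_measurable_fun.
  by apply: closed_openC; exact: closed_eq.
by move=> x; rewrite inE => /eqP x0; exact: inv_continuous.
Qed.

Variables (T a b : R).
(** One phase serves both averages: [a = 1], [b = - (pi / 2)] gives the sine, and [a = 2], [b = 0]
    the double angle coming from its square. *)
Let u (t : R) := a / (T - t) + b.

Lemma measurable_phase : measurable_fun setT u.
Proof.
apply: measurable_funD => //; apply: measurable_funM => //.
apply: (measurableT_comp measurable_inv).
exact: measurable_funB.
Qed.

Let is_derive_phase (t : R) : t < T -> is_derive t (1 : R) u (a / (T - t) ^+ 2).
Proof.
move=> tT; have Tt : T - t != 0 by rewrite subr_eq0 gt_eqF.
have dT : is_derive t (1 : R) (fun t => T - t) (-1).
  by have := is_deriveB (is_derive_cst T t 1) (is_derive_id t (1 : R)); rewrite sub0r.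
have dV : is_derive t (1 : R) (fun t => (T - t)^-1) ((T - t) ^- 2).
  have := @is_deriveV _ (fun t => T - t) t _ _ Tt dT.
  by move=> h; apply: is_derive_eq; rewrite scaleNr scalerN opprK scaler1.
by apply: is_derive_eq; rewrite addr0.
Qed.

(** The factor [(T - t) ^+ 2] cancels the singular derivative [a / (T - t) ^+ 2] of the phase; [f]
    is the derivative of [G]. *)
Let G (t : R) := (T - t) ^+ 2 * sin (u t).
Let f (t : R) := a * cos (u t) - 2 * (T - t) * sin (u t).

Let is_derive_G (t : R) : t < T -> is_derive t (1 : R) G (f t).
Proof.
move=> tT; have Tt : T - t != 0 by rewrite subr_eq0 gt_eqF.
have du := is_derive_phase tT.
have dT : is_derive t (1 : R) (fun t => T - t) (-1).
  by have := is_deriveB (is_derive_cst T t 1) (is_derive_id t (1 : R)); rewrite sub0r.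
have ds := is_derive1_comp (is_derive_sin (u t)) du.
have dX := is_deriveX 2 dT.
have := is_deriveM dX ds; rewrite /GRing.scale/= => h.
rewrite (_ : G = (fun t => T - t) ^+ 2 * (sin \o u)); last by apply/funext.
by apply: is_derive_eq; rewrite /f !fctE expr1; field.
Qed.

Let derivable_f (t : R) : t < T -> derivable f t 1.
Proof.
move=> tT; have du := is_derive_phase tT.
have ds := is_derive1_comp (is_derive_sin (u t)) du.
have dc := is_derive1_comp (is_derive_cos (u t)) du.
apply: derivableB; first by apply: derivableM => //; by case: dc.
by apply: derivableM; [apply: derivableM|by case: ds].
Qed.

Let integral_f (p q : R) : p < q -> q < T ->
  (\int[lebesgue_measure]_(t in `[p, q]) (f t)%:E = (G q - G p)%:E)%E.
Proof.
move=> pq qT; rewrite EFinB; apply: continuous_FTC2 => //.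
- apply: derivable_within_continuous => t; rewrite in_itv/= => /andP[_ tq].
  exact: derivable_f (le_lt_trans tq qT).
- have cG t : t < T -> {for t, continuous G}.
    move=> tT; apply/differentiable_continuous/derivable1_diffP.
    by case: (is_derive_G tT).
  split.
  + move=> t; rewrite in_itv/= => /andP[_ tq].
    by case: (is_derive_G (lt_trans tq qT)).
  + by apply/cvg_at_right_filter/cG/(lt_trans pq).
  + exact/cvg_at_left_filter/cG.
- move=> t; rewrite in_itv/= => /andP[_ tq].
  by rewrite derive1E; case: (is_derive_G (lt_trans tq qT)).
Qed.

Local Notation mu := (@lebesgue_measure R).

Let measure_Icc (p q : R) : p <= q -> mu `[p, q]%classic = (q - p)%:E.
Proof.
by move=> pq; rewrite lebesgue_measure_itv/= lte_fin; case: ltgtP pq => // -> _; rewrite subrr.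
Qed.

Lemma measurable_cos_phase : measurable_fun setT (fun t => cos (u t)).
Proof.
apply: measurableT_comp measurable_phase.
by apply: continuous_measurable_fun; exact: continuous_cos.
Qed.

Lemma measurable_sin_phase : measurable_fun setT (fun t => sin (u t)).
Proof.
apply: measurableT_comp measurable_phase.
by apply: continuous_measurable_fun; exact: continuous_sin.
Qed.

Let cos_norm_le1 x : `|cos x : R| <= 1.
Proof. by rewrite ler_norml cos_geN1 cos_le1. Qed.

Let sin_norm_le1 x : `|sin x : R| <= 1.
Proof. by rewrite ler_norml sin_geN1 sin_le1. Qed.

(** The boundary terms [G q] and [G p] contribute at most [(T - p) ^+ 2] each and the integral of
    [g] at most twice that, hence the 4. The bound is independent of [q], so [q] may approach
    [T]. *)
Lemma cos_phase_bound (p q : R) : 0 < a -> p < q -> q < T ->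
  `|\int[mu]_(t in `[p, q]) cos (u t)| <= 4 * (T - p) ^+ 2 / a.
Proof.
move=> a0 pq qT.
have mpq : (mu `[p, q]%classic < +oo)%E by rewrite measure_Icc ?ltry// ltW.
have Ic : mu.-integrable `[p, q] (EFin \o (fun t => cos (u t))).
  apply: (@bounded_integrable _ _ _ _ _ _ mpq _ 1) => //.
  exact: measurable_funS measurable_cos_phase.
pose g t := 2 * (T - t) * sin (u t).
have gb t : `[p, q]%classic t -> `|g t| <= 2 * (T - p).
  rewrite /= in_itv/= => /andP[pt tq].
  have Tt : 0 <= T - t by rewrite subr_ge0 (le_trans tq) ?ltW.
  rewrite /g normrM ger0_norm ?mulr_ge0// -[leRHS]mulr1.
  by apply: ler_pM => //; rewrite ?mulr_ge0// ler_pM2l// lerD2l lerN2.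
have Ig : mu.-integrable `[p, q] (EFin \o g).
  apply: (bounded_integrable _ mpq _ gb) => //.
  apply: measurable_funS (measurable_funM _ measurable_sin_phase) => //.
  by apply: measurable_funM => //; exact: measurable_funB.
have : \int[mu]_(t in `[p, q]) f t = G q - G p.
  by rewrite /Rintegral integral_f.
rewrite RintegralB//; last exact: (integrableZl _ a Ic).
rewrite RintegralZl// => /(canRL (subrK _)) E.
rewrite ler_pdivlMr// mulrC -{1}(gtr0_norm a0) -normrM E.
have Gb t : t <= T -> p <= t -> `|G t| <= (T - p) ^+ 2.
  move=> tT pt; rewrite /G normrM ger0_norm ?sqr_ge0// -[leRHS]mulr1.
  apply: ler_pM; rewrite ?sqr_ge0// lerXn2r ?nnegrE ?subr_ge0 ?(le_trans pt)//.
  by rewrite lerD2l lerN2.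
have := Gb q (ltW qT) (ltW pq); have := Gb p (ltW (lt_trans pq qT)) (lexx p).
have : `|\int[mu]_(t in `[p, q]) g t| <= 2 * (T - p) * (q - p).
  rewrite -[q - p]/(fine (q - p)%:E) -(measure_Icc (ltW pq)).
  apply: normr_Rintegral_le => //; by apply/measurable_EFinP; exact: measurable_int Ig.
move: (\int[mu]_(t in _) g t) => I hI hp hq.
have hD := ler_normD (G q - G p) I; have hB := ler_normB (G q) (G p).
have pT : 0 <= T - p by rewrite subr_ge0 ltW// (lt_trans pq).
have : 2 * (T - p) * (q - p) <= 2 * (T - p) * (T - p).
  by rewrite ler_wpM2l ?mulr_ge0// lerD2r ltW.
have -> : 2 * (T - p) * (T - p) = 2 * (T - p) ^+ 2 by ring.
by move=> hpq; lra.
Qed.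

End Oscillation.

(** * Averages over the time interval ending at the singular time *)

Section ParabolicAverage.
Variable R : realType.
Local Notation mu := (@lebesgue_measure R).
Variables (T r : R).
Hypothesis r_gt0 : 0 < r.

Lemma measurable_Iset : measurable (Iset T r : set (measurableTypeR R)).
Proof. exact: measurable_itv. Qed.

Lemma Iset_measure : mu (Iset T r) = (r ^+ 2)%:E.
Proof.
rewrite /Iset lebesgue_measure_itv/= lte_fin gtrBl exprn_gt0//.
by rewrite -EFinB opprB addrC subrK.
Qed.

Lemma Iset_gt0 : (0 < mu (Iset T r))%E.
Proof. by rewrite Iset_measure lte_fin exprn_gt0. Qed.

Lemma Iset_ltoo : (mu (Iset T r) < +oo)%E.
Proof. by rewrite Iset_measure ltry. Qed.

Lemma ravg_Iset (f : R -> R) :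
  ravg mu (Iset T r) f = (r ^+ 2)^-1 * Rintegral mu (Iset T r) f.
Proof. by rewrite /ravg -[r ^+ 2]/(fine (r ^+ 2)%:E) -Iset_measure. Qed.

Lemma ravg_cos_phase (a b : R) : 0 < a ->
  `|ravg mu (Iset T r) (fun t => cos (a / (T - t) + b))| <= 4 * r ^+ 2 / a.
Proof.
move=> a0; set f := fun t => _.
have mf : measurable_fun setT f by exact: measurable_cos_phase.
have fle1 t : `|f t| <= 1 by rewrite ler_norml cos_geN1 cos_le1.
have If (A : set (measurableTypeR R)) : measurable A -> (mu A < +oo)%E ->
    mu.-integrable A (EFin \o f).
  move=> mA Aoo; apply: (@bounded_integrable _ _ _ _ _ mA Aoo _ 1) => //.
  exact: measurable_funS mf.
have r2 : 0 < r ^+ 2 by rewrite exprn_gt0.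
rewrite ravg_Iset normrM gtr0_norm ?invr_gt0//.
rewrite ler_pdivrMl//.
have -> : r ^+ 2 * (4 * r ^+ 2 / a) = 4 * (r ^+ 2) ^+ 2 / a by ring.
apply/ler_addgt0Pr => e e0.
(* Cut at [T - d]: [cos_phase_bound] handles the part before, and the rest contributes at most
   [d <= e]. The cap [r ^+ 2 / 2] keeps the cut inside the interval. *)
pose d := Num.min e (r ^+ 2 / 2).
have d0 : 0 < d by rewrite lt_min e0 divr_gt0.
have de : d <= e by rewrite ge_min lexx.
have dr : d < r ^+ 2 by rewrite gt_min ltr_pdivrMr// ltr_pMr// ltr1n orbT.
have := @Rintegral_itvB R f (BRight (T - r ^+ 2)) (BRight T) (T - d).
rewrite !bnd_simp => /(_ (If _ (measurable_itv _) Iset_ltoo)).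
rewrite lerD2l lerN2 gerBl (ltW d0) (ltW dr) => /(_ isT isT) /(canRL (subrK _)) ->.
have Ipq : mu.-integrable `]T - r ^+ 2, T - d] (EFin \o f).
  by apply: If => //; rewrite lebesgue_measure_itv/=; case: ifP; rewrite -?EFinB ltry.
apply: (le_trans (ler_normD _ _)); rewrite [leLHS]addrC; apply: lerD.
  rewrite Rintegral_itv_obnd_cbnd//.
  have := @cos_phase_bound R T a b (T - r ^+ 2) (T - d) a0.
  rewrite ltrD2l ltrN2 gtrBl subKr => /(_ dr d0); exact.
have md : mu `]T - d, T]%classic = d%:E.
  by rewrite lebesgue_measure_itv/= lte_fin gtrBl d0 -EFinB subKr.
apply: (le_trans _ de); rewrite -[leRHS]mul1r -[X in 1 * X]/(fine d%:E) -md.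
have mdoo := ltry d; rewrite -md in mdoo.
apply: (normr_Rintegral_le _ mdoo) => //.
exact: measurable_funS mf.
Qed.

Let sin_phaseE t : sin (1 / (T - t)) = cos (1 / (T - t) + - (pi / 2)) :> R.
Proof. by rewrite cosBpihalf. Qed.

Lemma measurable_sin_inv : measurable_fun setT (fun t : R => sin (1 / (T - t))).
Proof.
rewrite (_ : (fun t => _) = fun t => cos (1 / (T - t) + - (pi / 2))).
  exact: measurable_cos_phase.
by apply/funext => t; rewrite sin_phaseE.
Qed.

Lemma ravg_sin_inv :
  `|ravg mu (Iset T r) (fun t => sin (1 / (T - t)))| <= 4 * r ^+ 2.
Proof.
rewrite (_ : (fun t => _) = fun t => cos (1 / (T - t) + - (pi / 2))).
  by rewrite (le_trans (ravg_cos_phase _ ltr01))// divr1.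
by apply/funext => t; rewrite sin_phaseE.
Qed.

(** The deviation is half the average of the cosine with [a = 2], and half of [4 * r ^+ 2 / 2] is
    [r ^+ 2]. *)
Lemma ravg_sqr_sin_inv :
  `|ravg mu (Iset T r) (fun t => sin (1 / (T - t)) ^+ 2) - 1 / 2| <= r ^+ 2.
Proof.
pose c t : R := cos (2 / (T - t) + 0).
rewrite (_ : (fun t => _) = fun t => 1 / 2 + (- (1 / 2)) * c t); last first.
  apply/funext => t; rewrite /c addr0.
  have -> : 2 / (T - t) = (1 / (T - t)) *+ 2 by rewrite -mulrnAl.
  by rewrite cos_mulr2n cos2sin2; field.
have Ic : mu.-integrable (Iset T r) (EFin \o c).
  apply: (@bounded_integrable _ _ _ _ _ measurable_Iset Iset_ltoo _ 1) => //.
    exact: measurable_funS (measurable_cos_phase _ _ _).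
  by move=> t _; rewrite ler_norml cos_geN1 cos_le1.
have Ih : mu.-integrable (Iset T r) (EFin \o (fun=> 1 / 2)).
  exact: (@bounded_integrable _ _ _ _ _ measurable_Iset Iset_ltoo _ `|1 / 2|).
rewrite (ravgD measurable_Iset Ih); last exact: (integrableZl measurable_Iset _ Ic).
rewrite (ravg_cst measurable_Iset Iset_gt0 Iset_ltoo).
rewrite (ravgZ measurable_Iset)// addrAC subrr add0r normrM normrN.
have half_gt0 : 0 < 1 / 2 :> R by rewrite divr_gt0.
have h : `|ravg mu (Iset T r) c| <= 4 * r ^+ 2 / 2 by exact: ravg_cos_phase.
by rewrite (gtr0_norm half_gt0); lra.
Qed.

End ParabolicAverage.

Section Limit.
Variable R : realType.

Definition sin_variance (T r : R) : R :=
  ravg (@lebesgue_measure R) (Iset T r) (fun t => sin (1 / (T - t)) ^+ 2) -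
  ravg (@lebesgue_measure R) (Iset T r) (fun t => sin (1 / (T - t))) ^+ 2.

Lemma sin_variance_cvg (T : R) : sin_variance T r @[r --> 0^'+] --> (1 / 2 : R).
Proof.
apply/cvgrPdist_le => e e0.
(* For [r < 1] the mean square deviates from 1/2 by at most [r], and the squared mean is at most
   [16 * r]; together [17 * r]. *)
have d0 : 0 < Num.min 1 (e / 17) by rewrite lt_min ltr01 divr_gt0.
near=> r.
have r0 : 0 < r by near: r; exact: nbhs_right_gt.
have : r < Num.min 1 (e / 17) by near: r; exact: nbhs_right_lt.
rewrite lt_min => /andP[r1 re].
have h1 := ravg_sqr_sin_inv T r0; have h2 := ravg_sin_inv T r0.
rewrite distrC /sin_variance.
move: (ravg _ _ _) h1 (ravg _ _ _) h2 => A hA s hs.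
have r2r : r ^+ 2 <= r by rewrite expr2 ger_pMr// ltW.
have : s ^+ 2 <= 16 * r.
  have -> : s ^+ 2 = `|s| ^+ 2 by rewrite real_normK ?num_real.
  apply: (@le_trans _ _ ((4 * r ^+ 2) ^+ 2)).
    by rewrite lerXn2r ?nnegrE// mulr_ge0// sqr_ge0.
  have r1r : r ^+ 2 <= 1 by rewrite (le_trans r2r)// ltW.
  rewrite exprMn -natrX ler_pM2l// (le_trans _ r2r)// [leLHS]expr2.
  by rewrite ger_pMr// exprn_gt0.
have := sqr_ge0 s; move: hA; rewrite !ler_norml => /andP[hA1 hA2] s0 s1.
by apply/andP; split; lra.
Unshelve. all: by end_near. Qed.

End Limit.

(** * Averages over parabolic cylinders *)

Section Product.
Local Open Scope ereal_scope.
Context d1 d2 (T1 : measurableType d1) (T2 : measurableType d2) (R : realType).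
Variable m1 : {sigma_finite_measure set T1 -> \bar R}.
Variable m2 : {sigma_finite_measure set T2 -> \bar R}.
Variables (A : set T1) (I : set T2).
Hypotheses (mA : measurable A) (mI : measurable I).

(** Tonelli with the first variable innermost: the integrand factors into the indicator of [A] and
    [k \_ I]. *)
Lemma ge0_integral_prod_snd (k : T2 -> \bar R) : measurable_fun setT k ->
  (forall t, 0 <= k t) ->
  \int[m1 \x m2]_(z in A `*` I) k z.2 = m1 A * \int[m2]_(t in I) k t.
Proof.
move=> mk k0.
have mkI : measurable_fun setT (k \_ I).
  by apply/(measurable_restrictT _ mI); exact: measurable_funS mk.
have kI0 t : 0 <= (k \_ I) t by rewrite patchE; case: ifP.
rewrite integral_mkcond [in RHS]integral_mkcond.
have -> : (fun z : T1 * T2 => k z.2) \_ (A `*` I) =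
    fun z => (\1_A z.1)%:E * (k \_ I) z.2.
  apply/funext => -[x t]; rewrite !patchE/= in_setX indicE.
  by case: (x \in A) => /=; rewrite ?mul0e// mul1e.
rewrite fubini_tonelli2.
- rewrite -ge0_integralZl//; apply: eq_integral => t _; rewrite /fubini_G/=.
  rewrite ge0_integralZr//; last exact: measurableT_comp.
  by rewrite integral_indic// setIT.
- apply: emeasurable_funM; last exact: measurableT_comp.
  by apply/measurable_EFinP; exact: measurableT_comp.
- by move=> z; rewrite mule_ge0// lee_fin.
Qed.

End Product.

Section Volume.
Variable R : realType.

HB.instance Definition _ := Measure.copy (@volume3 R)
  ((@lebesgue_measure R \x @lebesgue_measure R) \x @lebesgue_measure R)%E.

Lemma volume3_sigma_finite : sigma_finite setT (@volume3 R).
Proof.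
exists (fun n => Bset (Euclidean R) (0, 0, 0) n%:R); last first.
  by move=> n; split; [exact: measurable_Bset|exact: Bset_ltoo].
apply/esym/seteqP; split=> // x _.
have [n xn] : exists n, edist x (0, 0, 0) < n%:R.
  by exists (Num.truncn (edist x (0, 0, 0))).+1; exact: truncnS_gt.
by exists n.
Qed.

HB.instance Definition _ :=
  Measure_isSigmaFinite.Build _ _ _ (@volume3 R) volume3_sigma_finite.

End Volume.

Section ParabolicCylinder.
Variable R : realType.
Variables (S : spatial_domain R) (x0 : R * R * R) (T r : R).
Hypotheses (x0S : carrier S x0) (r_gt0 : 0 < r).

Local Notation Q := (Qset S (x0, T) r).
Local Notation mu := (@lebesgue_measure R).

Lemma measurable_Qset : measurable (Q : set (space4 R)).
Proof. by apply: measurableX; [exact: measurable_Bset|exact: measurable_Iset]. Qed.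

Lemma volume4_prod (A : set (space3 R)) (I : set (measurableTypeR R)) :
  measurable A -> measurable I ->
  @volume4 R (A `*` I) = (@volume3 R A * mu I)%E.
Proof. by move=> mA mI; rewrite /volume4 product_measure1E. Qed.

Lemma Qset_gt0 : (0 < @volume4 R Q)%E.
Proof.
rewrite volume4_prod; [|exact: measurable_Bset|exact: measurable_Iset].
by rewrite mule_gt0 ?Bset_gt0// Iset_gt0.
Qed.

Lemma Qset_ltoo : (@volume4 R Q < +oo)%E.
Proof.
rewrite volume4_prod; [|exact: measurable_Bset|exact: measurable_Iset].
by rewrite lte_mul_pinfty ?Iset_ltoo// ge0_fin_numE ?Bset_ltoo.
Qed.

Lemma ravg_Qset_snd (h : R -> R) (c : R) : measurable_fun setT h ->
  (forall t, `|h t| <= c) ->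
  ravg (@volume4 R) Q (fun z => h z.2) = ravg mu (Iset T r) h.
Proof.
(* The shift by [c] gives the nonnegativity required by Tonelli; it adds [c] to both averages and is
   cancelled by [addIr]. *)
move=> mh hc; pose k t := h t + c.
have k0 t : 0 <= k t by have := hc t; rewrite ler_norml /k => /andP[]; lra.
have IQ : (@volume4 R).-integrable Q (EFin \o (fun z => h z.2)).
  apply: (@bounded_integrable _ _ _ _ _ measurable_Qset Qset_ltoo _ c) => //.
  by apply: measurable_funTS; exact: measurableT_comp.
have II : mu.-integrable (Iset T r) (EFin \o h).
  apply: (@bounded_integrable _ _ _ _ _ (measurable_Iset _ _) (Iset_ltoo _ r_gt0) _ c) => //.
  exact: measurable_funS mh.
have IcQ : (@volume4 R).-integrable Q (EFin \o (fun=> c)).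
  exact: (@bounded_integrable _ _ _ _ _ measurable_Qset Qset_ltoo _ `|c|).
have IcI : mu.-integrable (Iset T r) (EFin \o (fun=> c)).
  exact: (@bounded_integrable _ _ _ _ _ (measurable_Iset _ _) (Iset_ltoo _ r_gt0) _ `|c|).
suff : ravg (@volume4 R) Q (fun z => k z.2) = ravg mu (Iset T r) k.
  rewrite (ravgD measurable_Qset IQ IcQ) (ravgD (measurable_Iset _ _) II IcI).
  rewrite (ravg_cst measurable_Qset Qset_gt0 Qset_ltoo).
  rewrite (ravg_cst (measurable_Iset _ _) (Iset_gt0 _ r_gt0) (Iset_ltoo _ r_gt0)).
  exact: addIr.
have B0 := fine_measure_gt0 (Bset_gt0 x0S r_gt0) (Bset_ltoo S x0 r).
have I0 := fine_measure_gt0 (Iset_gt0 T r_gt0) (Iset_ltoo T r_gt0).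
have mk : measurable_fun [set: measurableTypeR R] (fun t => (k t)%:E).
  by apply/measurable_EFinP; apply: measurable_funD.
have E := @ge0_integral_prod_snd _ _ _ _ R (@volume3 R) mu _ _
  (measurable_Bset S x0 r) (measurable_Iset T r) _ mk k0.
have Ek : fine (integral (@volume4 R) Q (fun z => (k z.2)%:E)) =
    fine (@volume3 R (Bset S x0 r)) * fine (integral mu (Iset T r) (fun t => (k t)%:E)).
  rewrite -fineM; first exact: (congr1 fine E).
    by rewrite ge0_fin_numE// Bset_ltoo.
  exact: (integrable_fin_num (measurable_Iset _ _) (integrableD (measurable_Iset _ _) II IcI)).
have EQ : fine (@volume4 R Q) = fine (@volume3 R (Bset S x0 r)) * fine (mu (Iset T r)).
  rewrite volume4_prod; [|exact: measurable_Bset|exact: measurable_Iset].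
  rewrite fineM// ge0_fin_numE//; [exact: Bset_ltoo|exact: Iset_ltoo].
rewrite /ravg /Rintegral Ek EQ invfM mulrACA mulVf ?mul1r//.
by rewrite gt_eqF.
Qed.

End ParabolicCylinder.

(** * Oscillations *)

Section Holder.
Variables (R : realType) (alpha : R) (N : matrix_norm R) (S : spatial_domain R).
Hypothesis alpha_gt0 : 0 < alpha.

(** Ensures that the supremum of Hölder quotients is over a nonempty set; the empty supremum would
    be [-oo]. *)
Lemma carrier_two_points : exists p q, [/\ carrier S p, carrier S q & p != q].
Proof.
case: S => [|L]; first exists (0, 0, 0), (1, 0, 0).
  by split=> //; rewrite !xpair_eqE eq_sym oner_eq0.
have L0 : 0 < L%:num by [].
exists (0, 0, 0), (L%:num / 2, 0, 0); split=> /=.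
- by rewrite lexx L0.
- by rewrite lexx L0 divr_ge0//= ltr_pdivrMr// ltr_pMr// ltr1n.
- by rewrite !xpair_eqE eq_sym gt_eqF// divr_gt0.
Qed.

Variables (f : R * R * R -> 'M[R]_3) (K : R).

(** Both suprema are nonnegative, so each is bounded by their sum. *)
Lemma Calpha_norm_le : (Calpha_norm N S alpha f <= K%:E)%E ->
  [/\ 0 <= K, forall x, carrier S x -> N (f x) <= K &
    forall x y, carrier S x -> carrier S y ->
      N (f x - f y) <= K * dist S x y `^ alpha].
Proof.
rewrite /Calpha_norm; set s1 := ereal_sup _; set s2 := ereal_sup _ => sK.
have [p [q [pS qS pq]]] := carrier_two_points.
have s1ub x : carrier S x -> ((N (f x))%:E <= s1)%E.
  by move=> xS; apply: ereal_sup_ubound; exists x.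
have s2ub x y : carrier S x -> carrier S y -> x != y ->
    ((N (f x - f y) / dist S x y `^ alpha)%:E <= s2)%E.
  by move=> xS yS xy; apply: ereal_sup_ubound; exists (x, y).
have s1_ge0 : (0 <= s1)%E.
  by apply: le_trans (s1ub p pS); rewrite lee_fin mxnorm_ge0.
have s2_ge0 : (0 <= s2)%E.
  apply: le_trans (s2ub p q pS qS pq).
  by rewrite lee_fin divr_ge0 ?mxnorm_ge0 ?powR_ge0.
have s1K : (s1 <= K%:E)%E by rewrite (le_trans _ sK)// leeDl.
have s2K : (s2 <= K%:E)%E by rewrite (le_trans _ sK)// leeDr.
have K0 : 0 <= K by rewrite -lee_fin (le_trans s1_ge0).
split=> // [x xS|x y xS yS].
  by rewrite -lee_fin (le_trans (s1ub _ xS)).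
have [->|xy] := eqVneq x y.
  by rewrite subrr mxnorm0 mulr_ge0// powR_ge0.
rewrite -ler_pdivrMr ?powR_gt0 ?dist_gt0//.
by rewrite -lee_fin (le_trans (s2ub _ _ xS yS xy)).
Qed.

Hypothesis K_ge0 : 0 <= K.
Hypothesis fK : forall x, carrier S x -> N (f x) <= K.
Hypothesis f_holder : forall x y, carrier S x -> carrier S y ->
  N (f x - f y) <= K * dist S x y `^ alpha.

Lemma holder_measurable_fun x0 r i j :
  measurable_fun (Bset S x0 r : set (space3 R)) (fun x => f x i j).
Proof.
have [c c0 fc] := entry_le_mxnorm N.
apply: continuous_measurable_fun3 => x [xS _] e e0.
have cK0 : 0 < c * K + 1 by rewrite ltr_wpDl// mulr_ge0.
have eK0 : 0 < e / (c * K + 1) by rewrite divr_gt0.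
pose d := (e / (c * K + 1)) `^ alpha^-1.
have d0 : 0 < d by rewrite powR_gt0.
have da : d `^ alpha = e / (c * K + 1).
  by rewrite /d -powRrM mulVf ?gt_eqF// powRr1// ltW.
exists (d / 3); first by rewrite divr_gt0.
move=> y [yS _] y1 y2 y3.
have xyd : dist S y x <= d.
  rewrite (le_trans (dist_le_edist _ _ _))// (le_trans (edist_le_sum _ _))//; lra.
have := fc (f y - f x) i j; rewrite !mxE => /le_lt_trans; apply.
apply: (@le_lt_trans _ _ (c * (K * d `^ alpha))).
  rewrite ler_wpM2l// (le_trans (f_holder yS xS))// ler_wpM2l//.
  by rewrite ge0_ler_powR ?nnegrE ?dist_ge0 ?(ltW alpha_gt0) ?(ltW d0).
rewrite da !mulrA ltr_pdivrMr//; lra.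
Qed.

Lemma holder_integrable x0 r i j :
  (@volume3 R).-integrable (Bset S x0 r) (fun x => (f x i j)%:E).
Proof.
have [c c0 fc] := entry_le_mxnorm N.
apply: (@bounded_integrable _ _ _ _ _ (measurable_Bset S x0 r) (Bset_ltoo S x0 r)
  (fun x => f x i j) (c * K)).
  exact: holder_measurable_fun.
by move=> x [xS _]; rewrite (le_trans (fc _ _ _))// ler_wpM2l// fK.
Qed.

Lemma holder_mean_dist x0 r : carrier S x0 -> 0 < r -> forall x, Bset S x0 r x ->
  N (f x - mxavg (@volume3 R) (Bset S x0 r) f) <= 2 * K * r `^ alpha.
Proof.
move=> x0S r0.
have near0 x : Bset S x0 r x -> N (f x - f x0) <= K * r `^ alpha.
  move=> [xS xr]; rewrite (le_trans (f_holder xS x0S))// ler_wpM2l//.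
  by rewrite ge0_ler_powR ?nnegrE ?dist_ge0 ?(ltW alpha_gt0) ?(ltW r0) ?(ltW xr).
move=> x Bx; set m := mxavg _ _ _.
have h0 : N (f x0 - m) <= K * r `^ alpha.
  apply: (mxavg_dist_le (measurable_Bset S x0 r) (Bset_gt0 x0S r0) (Bset_ltoo S x0 r)).
  - by rewrite mulr_ge0// powR_ge0.
  - by move=> i j; exact: holder_integrable.
  - by move=> y By; rewrite mxnormB near0.
rewrite -[f x](subrK (f x0)) -addrA (le_trans (mxnormD _ _ _))//.
by have := near0 _ Bx; lra.
Qed.

End Holder.

(** * The spatial estimate of part (1) *)

Section SpatialOscillation.
Variables (R : realType) (alpha : R) (N : matrix_norm R) (S : spatial_domain R).
Hypothesis alpha_gt0 : 0 < alpha.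

Lemma osc_space_le (J : set R) (M : R -> R * R * R -> 'M[R]_3) (K : R) :
  (ereal_sup [set Calpha_norm N S alpha (M t) | t in J] <= K%:E)%E ->
  forall z0 r, carrier S z0.1 -> 0 < r -> Qset S z0 r `<=` carrier S `*` J ->
  (osc_space N S M z0 r <= (2 * K * r `^ alpha)%:E)%E.
Proof.
move=> supK [x0 t0] r /= x0S r0 QJ.
(* Pairing [t] with the centre [x0] gives a point of the cylinder, so [t] lies in [J]. *)
have MK t : Iset t0 r t -> (Calpha_norm N S alpha (M t) <= K%:E)%E.
  move=> It; apply: le_trans supK; apply: ereal_sup_ubound; exists t => //.
  by have [] := QJ (x0, t) (conj (Bset_center x0S r0) It).
have It0 : Iset t0 r t0 by rewrite /Iset/= in_itv/= lexx andbT gtrBl exprn_gt0.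
have [K0 _ _] := Calpha_norm_le (MK _ It0).
set c := 2 * K * r `^ alpha.
have c0 : 0 <= c by rewrite !mulr_ge0// powR_ge0.
have -> : c%:E = sqrte (c ^+ 2)%:E by rewrite /= sqrtr_sqr ger0_norm.
rewrite /osc_space lee_sqrt ?lee_fin ?sqr_ge0//.
apply: avg_le_cst; [exact: measurable_Iset|exact: Iset_gt0|exact: Iset_ltoo|].
move=> t /MK /Calpha_norm_le[_ MtK Mth]; apply/andP; split.
  by apply: avg_ge0 => x _; rewrite lee_fin sqr_ge0.
apply: avg_le_cst; [exact: measurable_Bset|exact: Bset_gt0|exact: Bset_ltoo|].
move=> x Bx; rewrite !lee_fin sqr_ge0/= lerXn2r ?nnegrE ?mxnorm_ge0//.
exact: (holder_mean_dist alpha_gt0 K0 MtK Mth).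
Qed.

End SpatialOscillation.

(** * The oscillating field of part (2) *)

Section TemporalOscillation.
Variables (R : realType) (alpha : R) (N : matrix_norm R) (S : spatial_domain R).
Variables (T : R) (B : 'M[R]_3) (M : R -> R * R * R -> 'M[R]_3).
Hypothesis ME : forall t x, t < T -> carrier S x -> M t x = sin (1 / (T - t)) *: B.

Let sin_norm_le1 x : `|sin x : R| <= 1.
Proof. by rewrite ler_norml sin_geN1 sin_le1. Qed.

Lemma Calpha_norm_sin t : t < T ->
  Calpha_norm N S alpha (M t) = (`|sin (1 / (T - t))| * N B)%:E.
Proof.
move=> tT; have [p [q [pS qS pq]]] := carrier_two_points S.
rewrite /Calpha_norm.
rewrite (_ : [set _ | x in carrier S] = [set (`|sin (1 / (T - t))| * N B)%:E]).
  rewrite (_ : [set _ | p in _] = [set 0%E]); first by rewrite !ereal_sup1 adde0.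
  apply/seteqP; split=> [_ [[x y] /= [xS yS _] <-]|_ ->].
    by rewrite !ME// subrr mxnorm0 mul0r.
  by exists (p, q) => //=; rewrite !ME// subrr mxnorm0 mul0r.
apply/seteqP; split=> [_ [x xS <-]|_ ->]; first by rewrite ME// mxnormZ.
by exists p; rewrite // ME// mxnormZ.
Qed.

Lemma sup_Calpha_norm_sin :
  ereal_sup [set Calpha_norm N S alpha (M t) | t in [set t | t < T]] = (N B)%:E.
Proof.
apply/eqP; rewrite eq_le; apply/andP; split.
  apply: ge_ereal_sup => _ [t /= tT <-]; rewrite Calpha_norm_sin// lee_fin.
  by rewrite ler_piMl ?mxnorm_ge0.
have pi0 : 0 < pi :> R := pi_gt0 R.
(* At this time [1 / (T - t)] equals [pi / 2], so the supremum is attained. *)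
apply: ereal_sup_ubound; exists (T - 2 / pi).
  by rewrite /= gtrBl divr_gt0.
rewrite Calpha_norm_sin ?gtrBl ?divr_gt0// subKr mul1r invf_div sin_pihalf.
by rewrite normr1 mul1r.
Qed.

Variable x0 : R * R * R.
Hypothesis x0S : carrier S x0.
Variable r : R.
Hypothesis r_gt0 : 0 < r.

Local Notation mu := (@lebesgue_measure R).
Let s : R := ravg mu (Iset T r) (fun t => sin (1 / (T - t))).

Let IsetT t : Iset T r t -> ~ [set T] t -> t < T.
Proof.
rewrite /Iset/= in_itv/= => /andP[_ tT] tnT.
by rewrite lt_neqAle tT andbT; apply/eqP.
Qed.

Let mu_set1 : mu [set T] = 0%E.
Proof. exact: lebesgue_measure_set1. Qed.

(** The condition [~ set0 x] puts the formula in the shape expected by [mxavg_rank1], with empty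
    exceptional set. *)
Let ME_B t x : t < T -> Bset S x0 r x -> ~ set0 x -> M t x = sin (1 / (T - t)) *: B.
Proof. by move=> tT [xS _] _; exact: ME. Qed.

Lemma spatial_mean_sin t : t < T ->
  spatial_mean S M x0 r t = sin (1 / (T - t)) *: B.
Proof.
move=> tT; rewrite /spatial_mean.
rewrite (@mxavg_rank1 _ _ _ (@volume3 R) _ set0 (measurable_Bset S x0 r)
  (Bset_gt0 x0S r_gt0) (Bset_ltoo S x0 r) measurable0 (measure0 _)
  (fun=> sin (1 / (T - t))) 1 B (M t))//.
- by rewrite (ravg_cst (measurable_Bset S x0 r) (Bset_gt0 x0S r_gt0) (Bset_ltoo S x0 r)).
- by move=> x Bx; exact: ME_B.
Qed.

(** At each [t < T] the field coincides with its spatial mean on the ball; the remaining time [T] is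
    negligible. *)
Lemma osc_space_sin : osc_space N S M (x0, T) r = 0%E.
Proof.
rewrite /osc_space (@eq_avg_off_null _ _ _ _ _ (measurable_Iset T r) [set T]
  (measurable_set1 _) mu_set1 _ (cst 0%E))//.
  by rewrite /avg integral0 mule0 sqrte0.
move=> t It /(IsetT It) tT /=.
rewrite /avg integral0_eq ?mule0// => x [xS _].
by rewrite spatial_mean_sin// ME// subrr mxnorm0 expr0n.
Qed.

(** The top slice of the cylinder, where [M] is arbitrary; its time factor has measure zero. *)
Let Z := Bset S x0 r `*` [set T].

Let mZ : measurable (Z : set (space4 R)).
Proof. by apply: measurableX; [exact: measurable_Bset|exact: measurable_set1]. Qed.

Let Z0 : @volume4 R Z = 0%E.
Proof.
rewrite volume4_prod; [|exact: measurable_Bset|exact: measurable_set1].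
by rewrite [X in (_ * X)%E]mu_set1 mule0.
Qed.

Let ME_Q z : Qset S (x0, T) r z -> ~ Z z -> M z.2 z.1 = sin (1 / (T - z.2)) *: B.
Proof.
move=> [Bz Iz] nZz; apply: ME; last by case: Bz.
by apply: IsetT => // zT; apply: nZz.
Qed.

Let msin4 : measurable_fun (Qset S (x0, T) r : set (space4 R))
  (fun z => sin (1 / (T - z.2))).
Proof.
apply: measurable_funTS.
exact: (measurableT_comp (measurable_sin_inv T) measurable_snd).
Qed.

Lemma full_mean_sin : full_mean S M (x0, T) r = s *: B.
Proof.
rewrite /full_mean (@mxavg_rank1 _ _ _ (@volume4 R) _ Z (measurable_Qset S x0 T r)
  (Qset_gt0 T x0S r_gt0) (Qset_ltoo S x0 T r_gt0) mZ Z0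
  (fun z => sin (1 / (T - z.2))) 1 B)//.
by rewrite (ravg_Qset_snd T x0S r_gt0 (measurable_sin_inv T) (fun=> sin_norm_le1 _)).
Qed.

Lemma osc_full_sin : (osc_full N S M (x0, T) r ^+ 2)%E = (sin_variance T r * N B ^+ 2)%:E.
Proof.
rewrite /osc_full sqr_sqrte; last first.
  by apply: avg_ge0 => z _; rewrite lee_fin sqr_ge0.
rewrite full_mean_sin.
rewrite (@avg_sqr_rank1 _ _ _ (@volume4 R) _ Z (measurable_Qset S x0 T r)
  (Qset_gt0 T x0S r_gt0) (Qset_ltoo S x0 T r_gt0) mZ Z0
  (fun z => sin (1 / (T - z.2))) 1 B)//.
rewrite (ravg_Qset_snd T x0S r_gt0 (measurable_sin_inv T) (fun=> sin_norm_le1 _)).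
rewrite (@ravg_Qset_snd _ _ _ T _ x0S r_gt0 (fun t => sin (1 / (T - t)) ^+ 2) 1).
- by rewrite /sin_variance -/s; congr EFin; ring.
- exact: measurable_funX (measurable_sin_inv T).
- by move=> t; rewrite normrX expr_le1.
Qed.

(** Before [T] the spatial mean is the same scalar multiple of [B] as the field, so the temporal
    part carries the whole oscillation. *)
Lemma osc_time_sin : (osc_time N S M (x0, T) r ^+ 2)%E = (sin_variance T r * N B ^+ 2)%:E.
Proof.
rewrite /osc_time sqr_sqrte; last first.
  by apply: avg_ge0 => z _; rewrite lee_fin sqr_ge0.
rewrite full_mean_sin.
rewrite (@avg_sqr_rank1 _ _ _ mu _ [set T] (measurable_Iset T r)
  (Iset_gt0 T r_gt0) (Iset_ltoo T r_gt0) (measurable_set1 _) mu_set1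
  (fun t => sin (1 / (T - t))) 1 B)//.
- by rewrite /sin_variance -/s; congr EFin; ring.
- exact: measurable_funS (measurable_sin_inv T).
- by move=> t It tT; rewrite spatial_mean_sin//; exact: IsetT.
Qed.

End TemporalOscillation.

Theorem proposition6p5 (R : realType) (alpha : R)
    (alpha_gt0 : 0 < alpha) (alpha_lt1 : alpha < 1) :
  (exists C : R,
     forall (N : matrix_norm R) (S : spatial_domain R) (J : set R)
       (M : R -> R * R * R -> 'M[R]_3) (K : R),
     (ereal_sup [set Calpha_norm N S alpha (M t) | t in J] <= K%:E)%E ->
     forall (z0 : R * R * R * R) (r : R),
       carrier S z0.1 -> 0 < r -> Qset S z0 r `<=` carrier S `*` J ->
       (osc_space N S M z0 r <= (C * K * r `^ alpha)%:E)%E) /\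
  (forall (N : matrix_norm R) (S : spatial_domain R) (T : R) (B : 'M[R]_3)
     (M : R -> R * R * R -> 'M[R]_3),
     B != 0 ->
     (forall t x, t < T -> carrier S x -> M t x = sin (1 / (T - t)) *: B) ->
     ereal_sup [set Calpha_norm N S alpha (M t) | t in [set t | t < T]]
       = (N B)%:E /\
     (forall x0 : R * R * R, carrier S x0 ->
        [/\ forall r : R, 0 < r -> osc_space N S M (x0, T) r = 0%E,
            ((osc_full N S M (x0, T) r) ^+ 2)%E @[r --> 0^'+]
              --> (N B ^+ 2 / 2)%:E
          & ((osc_time N S M (x0, T) r) ^+ 2)%E @[r --> 0^'+]
              --> (N B ^+ 2 / 2)%:E])).
Proof.
split; first by exists 2 => N S J M K; exact: osc_space_le.
move=> N S T B M _ ME; split; first exact: sup_Calpha_norm_sin.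
move=> x0 x0S.
have lim : (sin_variance T r * N B ^+ 2)%:E @[r --> 0^'+] --> (N B ^+ 2 / 2)%:E.
  apply: cvg_EFin; first exact: nearW.
  rewrite [X in _ --> X](_ : _ = 1 / 2 * N B ^+ 2); last by rewrite mul1r mulrC.
  by apply: cvgMl; exact: sin_variance_cvg.
split.
- by move=> r r0; exact: (osc_space_sin _ ME).
(* The closed formula holds for [r > 0], which is enough for a limit from the right. *)
- apply: cvg_trans lim; apply: near_eq_cvg; near=> r.
  by rewrite (osc_full_sin _ ME x0S)//; near: r; exact: nbhs_right_gt.
- apply: cvg_trans lim; apply: near_eq_cvg; near=> r.
  by rewrite (osc_time_sin _ ME x0S)//; near: r; exact: nbhs_right_gt.
Unshelve. all: by end_near. Qed.
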